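(* Let $H$ be a hypergraph, let $U,V,W$ be pairwise disjoint subsets of the vertex set $V(H)$, and let $r$ be a real number. Then $(|e\cap U|-|e\cap V|):|e\cap W|=r$ for all $e\in E(H)$ (that is, $|e\cap U|-|e\cap V|=r\,|e\cap W|$ for all $e\in E(H)$) if and only if $r\chi_W-(\chi_U-\chi_V)$ belongs to the null space of $B_H$.
   Context: A hypergraph $H$ is a pair $(V(H),E(H))$ with $V(H)$ a non-empty finite set (vertices) and $E(H)$ a set of non-empty subsets of $V(H)$ (hyperedges). The edge-vertex incidence matrix $B_H=[b_{ev}]_{e\in E(H),v\in V(H)}$ has $b_{ev}=1$ if $v\in e$ and $b_{ev}=0$ otherwise; for a vector $x:V(H)\to\mathbb{C}$, $(B_Hx)(e)=\sum_{v\in e}x(v)$. For $U\subseteq V(H)$, $\chi_U:V(H)\to\{0,1\}$ is the characteristic function of $U$. The relation $a:b=r$ is understood as $a=rb$. *)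

(* Defs.v *)
From HB Require Import structures.
From mathcomp Require Import all_boot all_order all_algebra.
From mathcomp Require Import reals.
From mathcomp Require Import complex.
Set Implicit Arguments.
Unset Strict Implicit.
Unset Printing Implicit Defensive.
Import Order.TTheory GRing.Theory Num.Theory.
Local Open Scope ring_scope.

Record hypergraph := Hypergraph {
  vertex : finType;
  hyperedges : {set {set vertex}};
  vertex_nonempty : (0 < #|vertex|)%N;
  hyperedges_nonempty : set0 \notin hyperedges
}.

(* Functions on the vertices (resp. hyperedges) are column vectors, indexed   *)
(* through the enumerations [enum_val] of the vertex type (resp. edge set).   *)

Definition incidence_mx (F : nzRingType) (H : hypergraph) :
    'M[F]_(#|hyperedges H|, #|vertex H|) :=
  \matrix_(i, j) ((enum_val j : vertex H) \in (enum_val i : {set vertex H}))%:R.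

Definition char_vec (F : nzRingType) (H : hypergraph) (U : {set vertex H}) :
    'cV[F]_#|vertex H| :=
  \col_j ((enum_val j : vertex H) \in U)%:R.

(* MathComp's [kermx A] is the left kernel {u | u *m A = 0}; the null space   *)
(* {x | A *m x = 0} is the kernel of the linear map [mulmx A] on columns.     *)
Definition null_space (F : fieldType) (m n : nat) (A : 'M[F]_(m, n)) :
    {vspace 'cV[F]_n} :=
  lker (linfun (mulmx A : 'cV[F]_n -> 'cV[F]_m)).

(* Main.v *)
Require Import Defs.
From HB Require Import structures.
From mathcomp Require Import all_boot all_order all_algebra.
From mathcomp Require Import reals.
From mathcomp Require Import complex.
Import Order.TTheory GRing.Theory Num.Theory.
Local Open Scope ring_scope.
Local Open Scope complex_scope.

(** The incidence matrix sends the characteristic vector of [U] to the vector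
    whose entry at a hyperedge [e] is [#|e :&: U|] ([incidence_char_vec]). By
    linearity, the entry at [e] of the image of
    [r *: chi_W - (chi_U - chi_V)] is
    [r * #|e :&: W| - (#|e :&: U| - #|e :&: V|)], so this vector is in the null
    space exactly when the ratio identity holds at every hyperedge. The
    identity is between real numbers and the null space is complex; the two
    agree because the embedding of the reals is an injective ring morphism. *)

Lemma mem_null_space (F : fieldType) (m n : nat) (A : 'M[F]_(m, n))
    (x : 'cV[F]_n) :
  (x \in null_space A) = (A *m x == 0).
Proof. by rewrite memv_ker lfunE. Qed.

(** The product of the indicators of [e] and [U] is the indicator of
    [e :&: U], and the enumeration of the vertices turns the sum over column
    indices into a count of vertices. *)
Lemma incidence_char_vec (F : nzRingType) (H : hypergraph)
    (U : {set vertex H}) (i : 'I_#|hyperedges H|) (j : 'I_1) :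
  (incidence_mx F H *m char_vec F U) i j =
  #|(enum_val i : {set vertex H}) :&: U|%:R.
Proof.
rewrite mxE -[in RHS]sum1_card natr_sum [RHS]big_mkcond /=.
rewrite [RHS](reindex (@enum_val _ (mem (vertex H)))) /=; last first.
  by exists enum_rank => v _; rewrite ?enum_valK ?enum_rankK.
apply: eq_bigr => k _; rewrite !mxE inE.
by case: (_ \in enum_val i); case: (_ \in U); rewrite ?mulr0 ?mul0r ?mulr1.
Qed.

Theorem theorem2p18 (R : realType) (H : hypergraph)
    (U V W : {set vertex H}) (r : R)
    (disjUV : [disjoint U & V]) (disjUW : [disjoint U & W])
    (disjVW : [disjoint V & W]) :
  (forall e : {set vertex H}, e \in hyperedges H ->
     #|e :&: U|%:R - #|e :&: V|%:R = r * #|e :&: W|%:R)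
  <->
  r%:C *: char_vec R[i] W - (char_vec R[i] U - char_vec R[i] V)
    \in null_space (incidence_mx R[i] H).
Proof.
rewrite mem_null_space.
set x := (X in _ *m X).
have imageE i j : (incidence_mx R[i] H *m x) i j =
    (r * #|(enum_val i : {set vertex H}) :&: W|%:R
     - (#|(enum_val i : {set vertex H}) :&: U|%:R
        - #|(enum_val i : {set vertex H}) :&: V|%:R))%:C.
  rewrite /x !mulmxBr -scalemxAr.
  rewrite [LHS]mxE [X in X + _]mxE [X in _ + X]mxE [X in _ - X]mxE.
  rewrite [X in _ - (_ + X)]mxE !incidence_char_vec.
  by rewrite !rmorphB rmorphM !rmorph_nat.
split=> [ratio | /eqP image0 e eH].
  apply/eqP/matrixP => i j.
  by rewrite imageE ratio ?enum_valP // subrr mxE.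
have := imageE (enum_rank_in eH e) 0.
rewrite image0 mxE enum_rankK_in // => /esym/eqP.
by rewrite fmorph_eq0 subr_eq0 => /eqP.
Qed.
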